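(* Let $N,\nu,\mu$ be positive integers, and let $A$ ($N\times N$), $S$ ($\nu\times\nu$), $R$ ($\mu\times\mu$), $f$ ($N\times\nu$) and $g$ ($N\times\mu$) be real matrices. If $f$ is an $S$-perfect structure over $A$ and $g$ is an $R$-perfect structure over $A^{T}$, then $g^{T}f$ is an $S$-perfect structure over $R^{T}$. That is, $$(Af=fS)\ \&\ (A^{T}g=gR)\ \Rightarrow\ (R^{T}g^{T}f=g^{T}fS).$$
   Context: For real matrices $A$ ($N\times N$), $S$ ($\nu\times\nu$) and $f$ ($N\times\nu$), $f$ is called an $S$-perfect structure over $A$ (a perfect structure over $A$ with parameters $S$) if $Af=fS$. *)

(* Defs.v *)
From HB Require Import structures.
From mathcomp Require Import all_boot all_order all_algebra.
From mathcomp Require Import reals.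

Set Implicit Arguments.
Unset Strict Implicit.
Unset Printing Implicit Defensive.

Import GRing.Theory.
Local Open Scope ring_scope.

Definition perfect_structure (K : realType) (N nu : nat)
    (A : 'M[K]_N) (S : 'M[K]_nu) (f : 'M[K]_(N, nu)) : Prop :=
  A *m f = f *m S.

(* Main.v *)
Require Import Defs.
From HB Require Import structures.
From mathcomp Require Import all_boot all_order all_algebra.
From mathcomp Require Import reals.

Set Implicit Arguments.
Unset Strict Implicit.
Unset Printing Implicit Defensive.

Import GRing.Theory.
Local Open Scope ring_scope.

Theorem theorem1 (K : realType) (N nu mu : nat)
    (N_gt0 : (0 < N)%N) (nu_gt0 : (0 < nu)%N) (mu_gt0 : (0 < mu)%N)
    (A : 'M[K]_N) (S : 'M[K]_nu) (R : 'M[K]_mu)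
    (f : 'M[K]_(N, nu)) (g : 'M[K]_(N, mu)) :
  perfect_structure A S f -> perfect_structure A^T R g ->
  perfect_structure R^T S (g^T *m f).
Proof.
rewrite /perfect_structure => Af_fS ATg_gR.
(* The transpose of [A^T *m g = g *m R] moves [A] from [g] onto [f]. *)
by rewrite mulmxA -trmx_mul -ATg_gR trmx_mul trmxK -!mulmxA Af_fS.
Qed.
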